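(* In EiGLasso (the algorithm described in the context), given the trace ratio $\rho=\operatorname{tr}(\Psi)/\operatorname{tr}(\Theta)$, it is sufficient to identify the diagonals of $\Theta$ and $\Psi$ only once after convergence. This leads to the identical estimate obtained by identifying the diagonals of $\Theta$ and $\Psi$ in every iteration to maintain the trace ratio $\rho$. At convergence, the diagonal elements of $(\Theta,\Psi)$ are adjusted by the scalar factor $$\Theta\gets\Theta+\frac{\operatorname{tr}(\Psi)-\rho\operatorname{tr}(\Theta)}{q+\rho p}\,I_p$$ (and correspondingly $\Psi\gets\Psi-\frac{\operatorname{tr}(\Psi)-\rho\operatorname{tr}(\Theta)}{q+\rho p}I_q$, with $\Theta,\Psi$ on the right-hand sides denoting the values before adjustment, so that $\Theta\oplus\Psi$ is unchanged).
   Context: $p,q,n\ge1$ are integers. $I_a$ is the $a\times a$ identity, $\otimes$ the Kronecker product, $\Theta\oplus\Psi=\Theta\otimes I_q+I_p\otimes\Psi$, $\operatorname{vec}$ stacks the columns of a matrix, $e_{a,i}$ is the $i$th standard basis vector of $\mathbb{R}^a$, and $\|A\|_{1,\mathrm{off}}=\sum_{i\ne j}|A_{ij}|$. Given data $Y^1,\dots,Y^n\in\mathbb{R}^{q\times p}$ and regularization parameters $\gamma_\Theta,\gamma_\Psi$, set $S=\frac1{nq}\sum_iY^{iT}Y^i$, $T=\frac1{np}\sum_iY^iY^{iT}$, $g(\Theta,\Psi)=q\operatorname{tr}(S\Theta)+p\operatorname{tr}(T\Psi)-\log|\Theta\oplus\Psi|$, $h(\Theta,\Psi)=q\gamma_\Theta\|\Theta\|_{1,\mathrm{off}}+p\gamma_\Psi\|\Psi\|_{1,\mathrm{off}}$,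 $f=g+h$. The problem is to minimize $f(\Theta,\Psi)$ over symmetric $\Theta\in\mathbb{R}^{p\times p}$, $\Psi\in\mathbb{R}^{q\times q}$ with $\Theta\oplus\Psi\succ0$. The pairs $(\Theta-cI_p,\Psi+cI_q)$, $c\in\mathbb{R}$, all have the same Kronecker sum, so the diagonals are not identifiable from $\Theta\oplus\Psi$; ''identifying the diagonals'' with trace ratio $\rho$ means replacing $(\Theta,\Psi)$ by the pair of this form whose trace ratio $\operatorname{tr}(\Psi)/\operatorname{tr}(\Theta)$ equals $\rho$. Gradient and Hessians at $(\Theta,\Psi)$, with $W=(\Theta\oplus\Psi)^{-1}$: $G_\Theta=qS-\sum_{i=1}^q(I_p\otimes e_{q,i})^TW(I_p\otimes e_{q,i})$ and $G_\Psi=pT-\sum_{j=1}^p(e_{p,j}\otimes I_q)^TW(e_{p,j}\otimes I_q)$ are the gradients of $g$ in $\Theta$ and $\Psi$, and $\operatorname{vec}(G)=[\operatorname{vec}(G_\Theta)^T,\operatorname{vec}(G_\Psi)^T]^T$. The exact Hessian is $H=P^T(W\otimes W)P$ with $P=[\sum_{i=1}^qI_p\otimes e_{q,i}\otimes I_p\otimes e_{q,i},\ \sum_{j=1}^pe_{p,j}\otimes I_q\otimes e_{p,j}\otimes I_q]$. The approximate Hessian $\hat H$, with integer parameter $K\ge1$, is defined from eigendecompositions $\Theta=Q_\Theta\Lambda_\Theta Q_\Theta^T$, $\Psi=Q_\Psi\Lambda_\Psi Q_\Psi^T$ with eigenvalues $\lambda_{\Theta,k}$, $\lambda_{\Psi,k}$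 in increasing order, $\Xi_{\Theta,k}=(\Lambda_\Theta+\lambda_{\Psi,k}I_p)^{-1}$, $\Xi_{\Psi,l}=(\Lambda_\Psi+\lambda_{\Theta,l}I_q)^{-1}$, as the block-diagonal matrix with diagonal blocks $(Q_\Theta\otimes Q_\Theta)\big[\sum_{k=1}^K\Xi_{\Theta,k}\otimes\Xi_{\Theta,k}+(q-K)\Xi_{\Theta,K}\otimes\Xi_{\Theta,K}\big](Q_\Theta\otimes Q_\Theta)^T$ and $(Q_\Psi\otimes Q_\Psi)\big[\sum_{l=1}^K\Xi_{\Psi,l}\otimes\Xi_{\Psi,l}+(p-K)\Xi_{\Psi,K}\otimes\Xi_{\Psi,K}\big](Q_\Psi\otimes Q_\Psi)^T$. EiGLasso: initialize $\Theta=I_p$, $\Psi=I_q$. In each iteration, (1) compute $G$ and the Hessian $B$, where $B=H$ (exact version) or $B=\hat H$ (approximate version); (2) determine the active sets $\mathcal A_\Theta=\{(i,j):\Theta_{ij}\ne0\text{ or }|[G_\Theta]_{ij}|>q\gamma_\Theta\}$ and $\mathcal A_\Psi=\{(i,j):\Psi_{ij}\ne0\text{ or }|[G_\Psi]_{ij}|>p\gamma_\Psi\}$; (3) compute the Newton directions $(D_\Theta,D_\Psi)$ by coordinate descent over the active sets (entries outside them being set to zero) for the problem of minimizing over $(\Delta_\Theta,\Delta_\Psi)$ the function $\operatorname{vec}(G)^Tv+\frac12v^TBv+h(\Theta+\Delta_\Theta,\Psi+\Delta_\Psi)$, $v=[\operatorname{vec}(\Delta_\Theta)^T,\operatorname{vec}(\Delta_\Psi)^T]^T$;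 (4) choose the step size $\alpha$ as the first element of $1,\beta,\beta^2,\dots$ such that $(\Theta+\alpha D_\Theta)\oplus(\Psi+\alpha D_\Psi)\succ0$ and $f(\Theta+\alpha D_\Theta,\Psi+\alpha D_\Psi)\le f(\Theta,\Psi)+\alpha\sigma\delta$, where $0<\sigma<0.5$, $0<\beta<1$ are fixed, $\delta=\operatorname{vec}(D)^T\operatorname{vec}(G)+h(\Theta+D_\Theta,\Psi+D_\Psi)-h(\Theta,\Psi)$ and $\operatorname{vec}(D)=[\operatorname{vec}(D_\Theta)^T,\operatorname{vec}(D_\Psi)^T]^T$; (5) update $\Theta\gets\Theta+\alpha D_\Theta$, $\Psi\gets\Psi+\alpha D_\Psi$; (6) check convergence. After convergence, the diagonals of $\Theta$ and $\Psi$ are adjusted according to the trace ratio $\rho$.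
   Formalization: Added assumption: before stopping, in both runs, every diagonal position belongs to the active sets. Otherwise a diagonal entry that is zero in only one run may be screened out there alone, and the estimates can differ (example with p=2, q=n=1). *)

(* Defs.v *)
(* MathComp / MathComp-Analysis. *)
From mathcomp Require Import all_boot all_order all_algebra.
From mathcomp Require Import mxtens.
From mathcomp Require Import boolp classical_sets reals exp.

Set Implicit Arguments.
Unset Strict Implicit.
Unset Printing Implicit Defensive.

Import Order.TTheory GRing.Theory Num.Theory.

Local Open Scope ring_scope.

Section Matrices.
Variable R : realType.

(* [mxvec] stacks rows, whence the transpose. *)
Definition vec m n (A : 'M[R]_(m, n)) : 'cV[R]_(n * m) := (mxvec A^T)^T.

Definition ksum p q (Theta : 'M[R]_p) (Psi : 'M[R]_q) : 'M[R]_(p * q) :=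
  tensmx Theta (1%:M : 'M[R]_q) + tensmx (1%:M : 'M[R]_p) Psi.

Definition posdef m (A : 'M[R]_m) : Prop :=
  A^T = A /\ forall u : 'cV[R]_m, u != 0 -> 0 < (u^T *m A *m u) 0 0.

Definition offnorm m (A : 'M[R]_m) : R :=
  \sum_(i < m) \sum_(j < m | j != i) `|A i j|.

(* I_p (x) e_{q,i} and e_{p,j} (x) I_q. *)
Definition I_kron_e p q (i : 'I_q) : 'M[R]_(p * q, p) :=
  castmx (erefl _, muln1 p)
    (tensmx (1%:M : 'M[R]_p) (delta_mx i 0 : 'cV[R]_q)).

Definition e_kron_I p q (j : 'I_p) : 'M[R]_(p * q, q) :=
  castmx (erefl _, mul1n q)
    (tensmx (delta_mx j 0 : 'cV[R]_p) (1%:M : 'M[R]_q)).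

(* A = Q diag(lam) Q^T with Q orthogonal and lam in increasing order;
   the k-th eigenvalue in 1-based numbering is [lam`_k.-1]. *)
Definition eigendecomp m (A Q : 'M[R]_m) (lam : m.-tuple R) : Prop :=
  [/\ Q^T *m Q = 1%:M, sorted <=%R lam
    & A = Q *m diag_mx (\row_i tnth lam i) *m Q^T].

End Matrices.

Section Algorithm.
Variables (R : realType) (p q n : nat).

(* A pair (Theta, Psi), or a pair of increments (Delta_Theta, Delta_Psi). *)
Definition mxpair : Type := ('M[R]_p * 'M[R]_q)%type.

Record problem := Problem {
  sample : 'I_n -> 'M[R]_(q, p);
  gamma_Theta : R;
  gamma_Psi : R }.

Definition Omega (s : mxpair) : 'M[R]_(p * q) := ksum s.1 s.2.

Definition vecpair (s : mxpair) : 'cV[R]_(p * p + q * q) :=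
  col_mx (vec s.1) (vec s.2).

(* Coordinates of a pair of symmetric matrices: the entries (i, j) and (j, i)
   of one of the two matrices are moved together. *)
Definition coord : Type := (('I_p * 'I_p) + ('I_q * 'I_q))%type.

Definition sym_unit m (ij : 'I_m * 'I_m) : 'M[R]_m :=
  if ij.1 == ij.2 then delta_mx ij.1 ij.1
  else delta_mx ij.1 ij.2 + delta_mx ij.2 ij.1.

Definition coord_dir (c : coord) : mxpair :=
  match c with
  | inl ij => (sym_unit ij, 0)
  | inr ij => (0, sym_unit ij)
  end.

Definition active_sets : Type := ({set 'I_p * 'I_p} * {set 'I_q * 'I_q})%type.

Definition is_active (A : active_sets) (c : coord) : bool :=
  match c with
  | inl ij => ij \in A.1
  | inr ij => ij \in A.2
  end.

Definition is_argmin (phi : R -> R) (t : R) : Prop := forall u, phi t <= phi u.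

(* Exact minimization of the model m along one coordinate, for the active
   coordinates only.  A minimizer exists as soon as the quadratic part of the
   model is positive definite along the coordinate, so that the default value
   of [xget] is then irrelevant. *)
Definition cd_step (m : mxpair -> R) (A : active_sets)
    (Delta : mxpair) (c : coord) : mxpair :=
  if is_active A c then
    Delta + xget 0 [set t | is_argmin
              (fun t => m (Delta + t *: coord_dir c)) t]%classic *: coord_dir c
  else Delta.

Definition coordinate_descent (m : mxpair -> R) (A : active_sets)
    (cs : seq coord) : mxpair :=
  foldl (cd_step m A) 0 cs.

Inductive hessian_version := Exact | Approx of nat.

(* The eigenvalues of index K have to exist. *)
Definition valid_version (v : hessian_version) : Prop :=
  match v with
  | Exact => True
  | Approx K => [/\ 1 <= K, K <= p & K <= q]%N
  end.

(* [schedule t m A] lists the coordinates visited, in order, at iteration t for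
   the subproblem with model m and active sets A: the visiting order and the
   number of sweeps are arbitrary.
   [conv_test t W W' D] is the convergence test performed at the end of
   iteration t, where W and W' are the values of the Kronecker sum before and
   after the update and D is the Newton direction. *)
Record options := Options {
  version : hessian_version;
  schedule : nat -> (mxpair -> R) -> active_sets -> seq coord;
  sigma : R;
  beta : R;
  conv_test : nat -> 'M[R]_(p * q) -> 'M[R]_(p * q) -> mxpair -> bool }.

Section Objective.
Variable P : problem.

Definition S_gram : 'M[R]_p :=
  ((n * q)%:R)^-1 *: \sum_(i < n) ((sample P i)^T *m sample P i).

Definition T_gram : 'M[R]_q :=
  ((n * p)%:R)^-1 *: \sum_(i < n) (sample P i *m (sample P i)^T).

Definition g (s : mxpair) : R :=
  q%:R * \tr (S_gram *m s.1) + p%:R * \tr (T_gram *m s.2) - ln (\det (Omega s)).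

Definition h (s : mxpair) : R :=
  q%:R * gamma_Theta P * offnorm s.1 + p%:R * gamma_Psi P * offnorm s.2.

Definition f (s : mxpair) : R := g s + h s.

Definition gradient (s : mxpair) : mxpair :=
  let W := invmx (Omega s) in
  (q%:R *: S_gram - \sum_(i < q) (I_kron_e R p i)^T *m W *m I_kron_e R p i,
   p%:R *: T_gram - \sum_(j < p) (e_kron_I R q j)^T *m W *m e_kron_I R q j).

Definition active (s : mxpair) : active_sets :=
  ([set ij | (s.1 ij.1 ij.2 != 0)
             || (q%:R * gamma_Theta P < `|(gradient s).1 ij.1 ij.2|)]%SET,
   [set ij | (s.2 ij.1 ij.2 != 0)
             || (p%:R * gamma_Psi P < `|(gradient s).2 ij.1 ij.2|)]%SET).

(* No diagonal coordinate is screened out by the active sets. *)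
Definition diag_active (s : mxpair) : Prop :=
  (forall i, (i, i) \in (active s).1) /\ (forall j, (j, j) \in (active s).2).

End Objective.

Definition exact_hessian (s : mxpair) : 'M[R]_(p * p + q * q) :=
  let W := invmx (Omega s) in
  let PP : 'M[R]_((p * q) * (p * q), p * p + q * q) :=
    row_mx (\sum_(i < q) tensmx (I_kron_e R p i) (I_kron_e R p i))
           (\sum_(j < p) tensmx (e_kron_I R q j) (e_kron_I R q j)) in
  PP^T *m tensmx W W *m PP.

(* The diagonal block attached to A, of order a, where [mu] lists the
   eigenvalues of the other matrix, of order b. *)
Definition approx_block a b (K : nat) (Q : 'M[R]_a) (lam : a.-tuple R)
    (mu : b.-tuple R) : 'M[R]_(a * a) :=
  let Xi k := invmx (diag_mx (\row_i tnth lam i) + (mu`_k)%:M) in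
  tensmx Q Q
  *m (\sum_(0 <= k < K) tensmx (Xi k) (Xi k)
      + (b%:R - K%:R) *: tensmx (Xi K.-1) (Xi K.-1))
  *m (tensmx Q Q)^T.

Definition is_approx_hessian (K : nat) (s : mxpair)
    (B : 'M[R]_(p * p + q * q)) : Prop :=
  exists Q1 lam1 Q2 lam2,
    [/\ eigendecomp s.1 Q1 lam1, eigendecomp s.2 Q2 lam2
      & B = block_mx (approx_block K Q1 lam1 lam2) 0
                     0 (approx_block K Q2 lam2 lam1)].

(* [is_approx_hessian K s] holds of exactly one matrix (it does not depend on
   the choice of the eigenvectors) when s is a pair of symmetric matrices with
   a positive definite Kronecker sum. *)
Definition hessian (v : hessian_version) (s : mxpair) :
    'M[R]_(p * p + q * q) :=
  match v with
  | Exact => exact_hessian s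
  | Approx K => xget 0 [set B | is_approx_hessian K s B]%classic
  end.

Section Iterations.
Variables (P : problem) (O : options).

Definition model (s Delta : mxpair) : R :=
  let v := vecpair Delta in
  ((vecpair (gradient P s))^T *m v) 0 0
  + 2^-1 * (v^T *m hessian (version O) s *m v) 0 0
  + h P (s + Delta).

Definition newton_direction (t : nat) (s : mxpair) : mxpair :=
  let m := model s in
  let A := active P s in
  coordinate_descent m A (schedule O t m A).

Definition acceptable (s D : mxpair) (alpha : R) : Prop :=
  let delta := ((vecpair D)^T *m vecpair (gradient P s)) 0 0
               + h P (s + D) - h P s in
  posdef (Omega (s + alpha *: D)) /\
  f P (s + alpha *: D) <= f P s + alpha * sigma O * delta.

Definition is_step_size (s D : mxpair) (alpha : R) : Prop :=
  exists k, [/\ alpha = beta O ^+ k, acceptable s D (beta O ^+ k)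
              & forall j, (j < k)%N -> ~ acceptable s D (beta O ^+ j)].

(* Should no power of beta be acceptable, the line search returns 0. *)
Definition step_size (s D : mxpair) : R :=
  xget 0 [set alpha | is_step_size s D alpha]%classic.

Definition newton_step (t : nat) (s : mxpair) : mxpair :=
  let D := newton_direction t s in s + step_size s D *: D.

(* The iterates when each update is followed by the transformation [post]. *)
Fixpoint iterates (post : mxpair -> mxpair) (t : nat) : mxpair :=
  if t is t'.+1 then post (newton_step t' (iterates post t'))
  else (1%:M, 1%:M).

(* The first successful convergence test occurs after N iterations. *)
Definition stops_after (x : nat -> mxpair) (N : nat) : Prop :=
  let test t := conv_test O t (Omega (x t)) (Omega (x t.+1))
                          (newton_direction t (x t)) in
  [/\ (0 < N)%N, test N.-1 & forall t, (t < N.-1)%N -> ~~ test t].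

End Iterations.

Definition is_identification (rho : R) (s s' : mxpair) : Prop :=
  (exists c : R, s' = (s.1 - c%:M, s.2 + c%:M)) /\
  (\tr s'.1 != 0 /\ \tr s'.2 / \tr s'.1 = rho).

(* Such a pair is unique; it exists as soon as q + rho * p and the trace of
   the Kronecker sum are nonzero. *)
Definition identify (rho : R) (s : mxpair) : mxpair :=
  xget s [set s' | is_identification rho s s']%classic.

(* Diagonals left alone during the iterations, resp. identified with trace
   ratio rho in every iteration. *)
Definition eiglasso (P : problem) (O : options) : nat -> mxpair :=
  iterates P O id.

Definition eiglasso_identified (rho : R) (P : problem) (O : options) :
    nat -> mxpair :=
  iterates P O (identify rho).

End Algorithm.

(* Main.v *)
Require Import Defs.
From mathcomp Require Import all_boot all_order all_algebra.
From mathcomp Require Import reals.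
From mathcomp Require Import mxtens ring lra boolp classical_sets exp.

Set Implicit Arguments.
Unset Strict Implicit.
Unset Printing Implicit Defensive.

Import Order.TTheory GRing.Theory Num.Theory.
Local Open Scope ring_scope.

(* Moving (Theta, Psi) to (Theta - c I, Psi + c I) changes neither the Kronecker
   sum, nor the off-diagonal entries, nor the eigenvalue sums lambda_Theta +
   lambda_Psi, and it leaves g unchanged because q tr S = p tr T.  Hence the
   subproblem, the active sets, the Newton direction and the step size are the
   same at both pairs, so every iterate of one run is a shift of the iterate of
   the other.  Positive definiteness of the Kronecker sum gives
   q tr Theta + p tr Psi > 0, which is what makes the pair with a given trace
   ratio exist in each family of shifts. *)

(** * Kronecker sums, positive definiteness and spectra under scalar shifts *)

Section Matrices.
Variable R : realType.

Lemma mxtrace_tens m n (A : 'M[R]_m) (B : 'M[R]_n) :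
  \tr (tensmx A B) = \tr A * \tr B.
Proof. by rewrite /mxtrace mulr_sum; apply: eq_bigr => i _; rewrite mxE. Qed.

Lemma mxtrace_ksum m n (A : 'M[R]_m) (B : 'M[R]_n) :
  \tr (ksum A B) = n%:R * \tr A + m%:R * \tr B.
Proof. by rewrite mxtraceD !mxtrace_tens !mxtrace1 mulrC. Qed.

Lemma ksum_shift m n (c : R) (A : 'M[R]_m) (B : 'M[R]_n) :
  ksum (A - c%:M) (B + c%:M) = ksum A B.
Proof.
apply/matrixP => x y.
case: (mxtens_indexP x) => i k; case: (mxtens_indexP y) => j l.
rewrite [LHS]mxE [RHS]mxE !tensmxE !mxE.
case: (i == j); case: (k == l); rewrite !(mulr0n, mulr1n); ring.
Qed.

Lemma offnorm_shift m (c : R) (A : 'M[R]_m) : offnorm (A + c%:M) = offnorm A.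
Proof.
apply: eq_bigr => i _; apply: eq_bigr => j ji.
by rewrite !mxE eq_sym (negPf ji) mulr0n addr0.
Qed.

(** Each diagonal entry is the value of the quadratic form at a basis vector. *)
Lemma posdef_mxtrace_gt0 m (A : 'M[R]_m) :
  (0 < m)%N -> posdef A -> 0 < \tr A.
Proof.
move=> m0 [_ posA].
have posAii i : 0 < A i i.
  have := posA (delta_mx i 0); rewrite trmx_delta -rowE -colE !mxE; apply.
  by apply/eqP => /matrixP /(_ i 0); rewrite !mxE !eqxx => /eqP; rewrite oner_eq0.
rewrite /mxtrace (bigD1 (Ordinal m0)) //= ltr_pwDl //.
by apply: sumr_ge0 => i _; apply: ltW.
Qed.

Lemma posdef_ksum1 m n : posdef (ksum (1%:M : 'M[R]_m) (1%:M : 'M[R]_n)).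
Proof.
(* At the starting pair the quadratic form is twice a sum of squares. *)
have -> : ksum (1%:M : 'M[R]_m) (1%:M : 'M[R]_n) = 2%:M.
  apply/matrixP => x y.
  case: (mxtens_indexP x) => i k; case: (mxtens_indexP y) => j l.
  rewrite [LHS]mxE !tensmxE !mxE (can_eq (@mxtens_indexK _ _)) xpair_eqE.
  by case: (i == j); case: (k == l); rewrite !(mulr0n, mulr1n); ring.
split=> [|u u0]; first by rewrite tr_scalar_mx.
rewrite mul_mx_scalar -scalemxAl mxE mulr_gt0 // mxE lt_neqAle.
have sq_ge0 i : 0 <= u^T 0 i * u i 0 by rewrite mxE -expr2 sqr_ge0.
rewrite sumr_ge0 // andbT eq_sym; apply: contra u0.
rewrite psumr_eq0 // => /allP u0; apply/eqP/colP => i.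
by have := u0 i (mem_index_enum i); rewrite !mxE -expr2 sqrf_eq0 => /eqP.
Qed.

Lemma eigendecomp_shift m (c : R) (A Q : 'M[R]_m) (lam : m.-tuple R) :
  eigendecomp A Q lam ->
  eigendecomp (A + c%:M) Q (map_tuple (fun x => x + c) lam).
Proof.
move=> [QTQ lam_sorted ->]; split=> //.
  rewrite sorted_map; apply: sub_sorted lam_sorted => x y /=.
  by rewrite lerD2r.
have -> : \row_i tnth (map_tuple (fun x => x + c) lam) i =
          \row_i tnth lam i + const_mx c.
  by apply/rowP => i; rewrite !mxE tnth_map.
rewrite raddfD /= diag_const_mx mulmxDr mulmxDl mul_mx_scalar -scalemxAl.
by rewrite (mulmx1C QTQ) scalemx1.
Qed.

(** Opposite shifts of the two spectra cancel in each sum. The bound [K <= b] keeps every index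
    inside [mu], away from the default value of [nth], which would not be shifted. *)
Lemma approx_block_shift a b (K : nat) (c : R) (Q : 'M[R]_a)
    (lam : a.-tuple R) (mu : b.-tuple R) :
  (0 < K <= b)%N ->
  approx_block K Q (map_tuple (fun x => x + c) lam)
                   (map_tuple (fun x => x - c) mu) =
  approx_block K Q lam mu.
Proof.
move=> /andP[K0 Kb].
have XiE k : (k < K)%N ->
    invmx (diag_mx (\row_i tnth (map_tuple (fun x => x + c) lam) i)
           + ((map_tuple (fun x => x - c) mu)`_k)%:M) =
    invmx (diag_mx (\row_i tnth lam i) + (mu`_k)%:M).
  move=> kK; rewrite (nth_map 0) ?size_tuple ?(leq_trans kK) //.
  congr invmx; apply/matrixP => i j; rewrite !mxE tnth_map.
  case: (i == j); rewrite !(mulr0n, mulr1n); ring.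
have K1 : (K.-1 < K)%N by case: (K) K0.
rewrite /approx_block (XiE _ K1).
by under eq_big_nat => k /andP[_ kK] do rewrite (XiE k kK).
Qed.

End Matrices.

(** * Shift invariance of one iteration *)

Section Shift.
Variables (R : realType) (p q n : nat).
Hypotheses (p_gt0 : (0 < p)%N) (q_gt0 : (0 < q)%N) (n_gt0 : (0 < n)%N).
Variables (P : problem R p q n) (O : options R p q).
Hypothesis version_valid : valid_version p q (version O).
Implicit Types (s D : mxpair R p q) (c rho : R).

Definition shift c s : mxpair R p q := (s.1 - c%:M, s.2 + c%:M).

Lemma shiftDr c s D : shift c s + D = shift c (s + D).
Proof. by congr (_, _); rewrite addrAC. Qed.

Lemma shiftA c d s : shift c (shift d s) = shift (c + d) s.
Proof.
by congr (_, _); rewrite /= raddfD /= ?opprD -addrA; congr (_ + _); rewrite addrC.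
Qed.

Lemma shift0 s : shift 0 s = s.
Proof. by case: s => A B; rewrite /shift /= !raddf0 !addr0. Qed.

Lemma Omega_shift c s : Omega (shift c s) = Omega s.
Proof. exact: ksum_shift. Qed.

Lemma gradient_shift c s : gradient P (shift c s) = gradient P s.
Proof. by rewrite /gradient Omega_shift. Qed.

Lemma h_shift c s : h P (shift c s) = h P s.
Proof. by rewrite /h /= -raddfN !offnorm_shift. Qed.

(** By cyclicity of the trace, both sides are the average over the sample of tr(Y^T Y). *)
Lemma mxtrace_gram : q%:R * \tr (S_gram P) = p%:R * \tr (T_gram P).
Proof.
rewrite /S_gram /T_gram !mxtraceZ !raddf_sum /= !natrM.
under eq_bigr do rewrite mxtrace_mulC.
have ? : p%:R != 0 :> R by rewrite pnatr_eq0 -lt0n.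
have ? : q%:R != 0 :> R by rewrite pnatr_eq0 -lt0n.
have ? : n%:R != 0 :> R by rewrite pnatr_eq0 -lt0n.
by field; apply/and3P.
Qed.

Lemma f_shift c s : f P (shift c s) = f P s.
Proof.
rewrite /f h_shift /g Omega_shift /= mulmxBr mulmxDr !mul_mx_scalar.
rewrite mxtraceD [in LHS]raddfB /= !(mxtraceZ c).
have := mxtrace_gram; move: (\tr (S_gram P)) (\tr (T_gram P)) => a b ab.
have ac : q%:R * (c * a) = p%:R * (c * b) by rewrite mulrCA ab mulrCA.
by rewrite mulrBr mulrDr ac; ring.
Qed.

Lemma is_approx_hessian_shift K c s B : (0 < K)%N -> (K <= p)%N -> (K <= q)%N ->
  is_approx_hessian K s B -> is_approx_hessian K (shift c s) B.
Proof.
move=> K0 Kp Kq [Q1 [lam1 [Q2 [lam2 [eig1 eig2 ->]]]]].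
exists Q1, (map_tuple (fun x => x - c) lam1).
exists Q2, (map_tuple (fun x => x + c) lam2).
split; first by rewrite /= -raddfN; apply: eigendecomp_shift.
  exact: eigendecomp_shift.
have Kp' : (0 < K <= p)%N by rewrite K0.
have Kq' : (0 < K <= q)%N by rewrite K0.
have shift1 := approx_block_shift (- c) Q1 lam1 lam2 Kq'; rewrite opprK in shift1.
have shift2 := approx_block_shift c Q2 lam2 lam1 Kp'.
by rewrite shift1 shift2.
Qed.

Lemma hessian_shift c s : hessian (version O) (shift c s) = hessian (version O) s.
Proof.
move: version_valid; case: (version O) => [_|K [K0 Kp Kq]] /=.
  by rewrite /exact_hessian Omega_shift.
(* Equal sets of candidates give equal choices, with no appeal to existence or uniqueness; shifting
   back by [- c] gives the reverse inclusion. *)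
congr xget; apply/seteqP; split=> B /=; last exact: is_approx_hessian_shift.
by move/(is_approx_hessian_shift (- c)); rewrite shiftA addNr shift0; apply.
Qed.

(** An equality of functions, since [schedule] takes the model itself as an argument. *)
Lemma model_shift c s : model P O (shift c s) = model P O s.
Proof.
apply/funext => D.
by rewrite /model gradient_shift hessian_shift shiftDr h_shift.
Qed.

Lemma acceptable_shift c s D :
  acceptable P O (shift c s) D = acceptable P O s D.
Proof.
apply/funext => alpha.
by rewrite /acceptable !shiftDr Omega_shift !f_shift gradient_shift !h_shift.
Qed.

Lemma step_size_shift c s D : step_size P O (shift c s) D = step_size P O s D.
Proof. by rewrite /step_size /is_step_size acceptable_shift. Qed.

(* The two hypotheses are needed on the diagonal only, where a shift may create
   or remove a zero entry. *)
Lemma active_shift c s : diag_active P s -> diag_active P (shift c s) ->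
  active P (shift c s) = active P s.
Proof.
move=> [d1 d2] [e1 e2]; apply: injective_projections; apply/setP => -[i j].
  have [<-|ij] := eqVneq i j; first exact: etrans (e1 i) (esym (d1 i)).
  by rewrite !inE gradient_shift !mxE (negPf ij) mulr0n subr0.
have [<-|ij] := eqVneq i j; first exact: etrans (e2 i) (esym (d2 i)).
by rewrite !inE gradient_shift !mxE (negPf ij) mulr0n addr0.
Qed.

Lemma newton_direction_shift t c s :
  diag_active P s -> diag_active P (shift c s) ->
  newton_direction P O t (shift c s) = newton_direction P O t s.
Proof.
by move=> ds dsc; rewrite /newton_direction (active_shift ds dsc) model_shift.
Qed.

Lemma newton_step_shift t c s :
  diag_active P s -> diag_active P (shift c s) ->
  newton_step P O t (shift c s) = shift c (newton_step P O t s).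
Proof.
move=> ds dsc.
by rewrite /newton_step newton_direction_shift // step_size_shift shiftDr.
Qed.

Lemma posdef_newton_step t s :
  posdef (Omega s) -> posdef (Omega (newton_step P O t s)).
Proof.
move=> pos_s; rewrite /newton_step; set D := newton_direction P O t s.
(* An accepted step includes positive definiteness; the default step 0 leaves the pair in place. *)
rewrite /step_size; case: xgetP => [alpha _ [k [-> [] //]]|_].
by rewrite scale0r addr0.
Qed.

Lemma posdef_eiglasso t : posdef (Omega (eiglasso P O t)).
Proof.
elim: t => [|t IHt]; first exact: posdef_ksum1.
exact: posdef_newton_step.
Qed.

(** * Identification of the diagonals by the trace ratio *)

Lemma identify_is_shift rho s : exists c, identify rho s = shift c s.
Proof.
rewrite /identify; case: xgetP => [s' _ [[c ->] _]|_]; first by exists c.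
(* If no shift attains the ratio, [identify] returns [s] itself. *)
by exists 0; rewrite shift0.
Qed.

Lemma is_identification_shift rho c s s' :
  is_identification rho s s' -> is_identification rho (shift c s) s'.
Proof.
move=> [[d ->] tr_s']; split=> //; exists (d - c).
by rewrite -/(shift (d - c) (shift c s)) shiftA subrK.
Qed.

Lemma is_identification_uniq rho s s1 s2 : q%:R + rho * p%:R != 0 ->
  is_identification rho s s1 -> is_identification rho s s2 -> s1 = s2.
Proof.
move=> rho_ok [[c1 ->] [t1 r1]] [[c2 ->] [t2 r2]].
suff -> : c1 = c2 by [].
(* The ratio condition is linear in the shift, with coefficient q + rho p. *)
apply: (mulIf rho_ok).
move: t1 t2 r1 r2; rewrite /= !mxtraceD !raddfN /= !mxtrace_scalar => t1 t2.
move=> /(canRL (divfK t1)) r1 /(canRL (divfK t2)) r2.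
by rewrite -(mulr_natl c1) -(mulr_natl c2) in r1 r2 *; lra.
Qed.

Lemma identifyE rho s s' : q%:R + rho * p%:R != 0 ->
  is_identification rho s s' -> identify rho s = s'.
Proof.
move=> rho_ok s's; apply: xget_unique => // s'' s''s.
exact: is_identification_uniq s''s s's.
Qed.

Lemma is_identification_estimate rho s : q%:R + rho * p%:R != 0 ->
  posdef (Omega s) ->
  let c := (\tr s.2 - rho * \tr s.1) / (q%:R + rho * p%:R) in
  is_identification rho s (s.1 + c%:M, s.2 - c%:M).
Proof.
move=> rho_ok pos_s c; have := posdef_mxtrace_gt0 _ pos_s.
rewrite muln_gt0 p_gt0 q_gt0 /Omega mxtrace_ksum => /(_ isT) tr_gt0; split.
  have scN m : (- c)%:M = - c%:M :> 'M[R]_m by rewrite raddfN.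
  by exists (- c); rewrite !scN opprK.
rewrite /= !mxtraceD raddfN /= !mxtrace_scalar -!(mulr_natl c).
(* The numerator is the trace of the Kronecker sum, so the new trace of Theta is nonzero. *)
have trE : \tr s.1 + p%:R * c =
    (q%:R * \tr s.1 + p%:R * \tr s.2) / (q%:R + rho * p%:R).
  by rewrite /c; field.
have tr_neq0 : \tr s.1 + p%:R * c != 0.
  by rewrite trE mulf_neq0 ?invr_eq0 ?(gt_eqF tr_gt0).
split=> //; apply: (mulIf tr_neq0); rewrite divfK //.
by rewrite /c; field.
Qed.

(** * Comparison of the two runs *)

Lemma eiglasso_identified_is_shift rho N t :
  (forall k, (k < N)%N -> diag_active P (eiglasso P O k) /\
     diag_active P (eiglasso_identified rho P O k)) ->
  (t <= N)%N ->
  exists c, eiglasso_identified rho P O t = shift c (eiglasso P O t).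
Proof.
move=> diag; elim: t => [|t IHt] tN; first by exists 0; rewrite shift0.
have [c ec] := IHt (ltnW tN); have [d1] := diag t tN; rewrite ec => d2.
rewrite /eiglasso_identified /= -/(eiglasso_identified _ _ _ _) ec.
rewrite newton_step_shift //.
have [d ->] := identify_is_shift rho (shift c (newton_step P O t (eiglasso P O t))).
by rewrite shiftA; exists (d + c).
Qed.

(** The last Newton step of the identified run lands on a shift of the plain iterate, and all shifts
    of a pair have the same identification. At N = 0 the initial pair has not been identified yet,
    whence [0 < N]. *)
Lemma eiglasso_identifiedE rho N : q%:R + rho * p%:R != 0 -> (0 < N)%N ->
  (forall k, (k < N)%N -> diag_active P (eiglasso P O k) /\
     diag_active P (eiglasso_identified rho P O k)) ->
  eiglasso_identified rho P O N = identify rho (eiglasso P O N).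
Proof.
move=> rho_ok; case: N => [|N] N0 diag; first discriminate N0.
have [c yc] := eiglasso_identified_is_shift diag (leqnSn N).
have [d1] := diag N (ltnSn N); rewrite yc => d2.
have estP := is_identification_estimate rho_ok (posdef_eiglasso N.+1).
rewrite (identifyE rho_ok estP).
rewrite /eiglasso_identified [LHS]/= -/(eiglasso_identified _ _ _ _) yc.
rewrite (newton_step_shift _ d1 d2); apply: (identifyE rho_ok).
exact: is_identification_shift estP.
Qed.

(** The test ending iteration t sees the Kronecker sums at t and t + 1 but the direction only at t,
    which explains the two different bounds. *)
Lemma eq_stops_after (x y : nat -> mxpair R p q) N :
  (forall t, (t <= N)%N -> Omega (y t) = Omega (x t)) ->
  (forall t, (t < N)%N ->
     newton_direction P O t (y t) = newton_direction P O t (x t)) ->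
  stops_after P O x N -> stops_after P O y N.
Proof.
case: N => [|N] OmegaE dirE [N0 testN test]; first discriminate N0.
have dirN : newton_direction P O N (y N) = newton_direction P O N (x N).
  exact: dirE (ltnSn N).
split; first exact: N0.
  by rewrite /= (OmegaE N (leqnSn N)) (OmegaE N.+1 (leqnn _)) dirN; exact: testN.
move=> t tN; have tN1 : (t < N.+1)%N by apply: leq_trans tN _.
rewrite (OmegaE t (ltnW tN1)) (OmegaE t.+1 tN1) (dirE t tN1); exact: test.
Qed.

End Shift.

Theorem theorem8 (R : realType) (p q n : nat)
  (P : problem R p q n) (O : options R p q) (rho : R)
  (hp : (1 <= p)%N) (hq : (1 <= q)%N) (hn : (1 <= n)%N)
  (hversion : valid_version p q (version O))
  (hsigma : 0 < sigma O < 1 / 2) (hbeta : 0 < beta O < 1)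
  (hrho : q%:R + rho * p%:R != 0)
  (N : nat)
  (hdiag : forall t : nat, (t < N)%N ->
     diag_active P (eiglasso P O t) /\
     diag_active P (eiglasso_identified rho P O t)) :
  (stops_after P O (eiglasso P O) N <->
   stops_after P O (eiglasso_identified rho P O) N) /\
  (stops_after P O (eiglasso P O) N ->
   let Theta := (eiglasso P O N).1 in
   let Psi := (eiglasso P O N).2 in
   let c := (\tr Psi - rho * \tr Theta) / (q%:R + rho * p%:R) in
   let estimate := (Theta + c%:M, Psi - c%:M) in
   [/\ eiglasso_identified rho P O N = identify rho (eiglasso P O N),
       identify rho (eiglasso P O N) = estimate,
       is_identification rho (eiglasso P O N) estimate
     & ksum estimate.1 estimate.2 = ksum Theta Psi]).

Proof.
set x := eiglasso P O; set y := eiglasso_identified rho P O.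
have yE t : (t <= N)%N -> exists c, y t = shift c (x t).
  exact: eiglasso_identified_is_shift.
have OmegaE t : (t <= N)%N -> Omega (y t) = Omega (x t).
  by move=> /yE[c ->]; rewrite Omega_shift.
have dirE t : (t < N)%N ->
    newton_direction P O t (y t) = newton_direction P O t (x t).
  move=> tN; have [c yc] := yE t (ltnW tN); have [d1] := hdiag t tN.
  by rewrite -/y yc; apply: newton_direction_shift.
split.
  split; apply: eq_stops_after => t tN; first exact: OmegaE.
  - exact: dirE.
  - exact/esym/OmegaE.
  - exact/esym/dirE.
(* Stopping supplies [0 < N], so at least one identification has taken place. *)
move=> [N0 _ _] Theta Psi c estimate.
have xP := is_identification_estimate hp hq hrho (posdef_eiglasso P O N).
split; [|exact: identifyE hrho xP|exact: xP|].
  exact: eiglasso_identifiedE.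
have := ksum_shift (- c) Theta Psi.
by rewrite !raddfN /= opprK.
Qed.
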